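(* Let $G$ be an infinite countable group. If $G$ has the cyclic escape property, then every totally ergodic probability-measure-preserving action of $G$ is directionally expansive.
   Context: All unitary representations are on complex Hilbert spaces. For a unitary representation $(V,\pi)$ of a countable group $G$ and a subgroup $H\leq G$, write $V^H=\{v\in V:\pi(h)v=v\text{ for every }h\in H\}$ and let $P_H$ be the orthogonal projection onto $V^H$. The representation $(V,\pi)$ is totally ergodic if $V^H=\{0\}$ for every finite-index subgroup $H\leq G$. An infinite countable group $G$ has the cyclic escape property if, for every totally ergodic unitary representation $(V,\pi)$ of $G$ and every $v\in V$, $\inf_C\|P_Cv\|=0$, where the infimum is over all infinite cyclic subgroups $C\leq G$. A probability-measure-preserving action $G\curvearrowright(X,\mu)$ of a countable discrete group is totally ergodic if its restriction to every finite-index subgroup of $G$ is ergodic. It is directionally expansive if, for every measurable set $B\subset X$ with $\mu(B)>0$ and every $\varepsilon>0$, there exists a cyclic subgroup $C\leq G$ (finite or infinite) such that $\mu(CB)>1-\varepsilon$, where $CB=\bigcup_{c\in C}cB$. *)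

(* Defs.v *)
From HB Require Import structures.
From mathcomp Require Import all_boot all_order all_algebra.
From mathcomp Require Import complex.
From mathcomp Require Import all_classical all_reals all_analysis.

Set Implicit Arguments.
Unset Strict Implicit.
Unset Printing Implicit Defensive.

Import Order.TTheory GRing.Theory Num.Theory.
Import numFieldNormedType.Exports.

Local Open Scope classical_set_scope.
Local Open Scope ring_scope.

(* [groupType] is MathComp's structure of arbitrary (possibly infinite)       *)
(* groups; subgroups are classical sets of group elements.                    *)
Definition subgroup (G : groupType) (H : set G) : Prop := group_closed (mem H).

Definition finite_index (G : groupType) (H : set G) : Prop :=
  finite_set (range (fun g : G => [set (g * h)%g | h in H])).

Definition cyclic_subgroup (G : groupType) (C : set G) : Prop :=
  exists g : G, C = [set x | exists n : nat, x = (g ^+ n)%g \/ x = (g ^- n)%g].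

(* Complex Hilbert spaces: Banach spaces over R[i] whose norm comes from a    *)
(* positive definite Hermitian form, linear in its first argument.  The norm  *)
(* of a normed module over R[i] takes its (real, nonnegative) values in R[i]. *)
Record hilbert (R : realType) := Hilbert {
  hilbert_sort :> completeNormedModType R[i] ;
  hdot : {dot hilbert_sort for Num.conj} ;
  hdotE : forall v : hilbert_sort, hdot v v = `|v| ^+ 2 }.

Definition hnorm (R : realType) (V : hilbert R) (v : V) : R :=
  complex.Re `|v|.

(* Each pi g is a linear isometry; it is onto because pi g^-1 is its inverse. *)
Record unitary_rep (R : realType) (G : groupType) (V : hilbert R) :=
  UnitaryRep {
  rep_fun :> G -> {linear V -> V} ;
  rep1 : forall v : V, rep_fun 1%g v = v ;
  repM : forall (g h : G) (v : V), rep_fun (g * h)%g v = rep_fun g (rep_fun h v) ;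
  rep_dot : forall (g : G) (u v : V),
    hdot V (rep_fun g u) (rep_fun g v) = hdot V u v }.

Definition fixed_vectors (R : realType) (G : groupType) (V : hilbert R)
    (pi : unitary_rep G V) (H : set G) : set V :=
  [set v | forall h : G, H h -> pi h v = v].

(* Orthogonal projection of v on W: the unique w in W such that v - w is      *)
(* orthogonal to W.  It exists when W is a closed subspace, which is the case *)
(* of spaces of fixed vectors; the default value 0 is then never used.        *)
Definition orth_proj (R : realType) (V : hilbert R) (W : set V) (v : V) : V :=
  xget 0 [set w | W w /\ forall u : V, W u -> hdot V (v - w) u = 0].

Definition totally_ergodic_rep (R : realType) (G : groupType) (V : hilbert R)
    (pi : unitary_rep G V) : Prop :=
  forall H : set G, subgroup H -> finite_index H ->
    fixed_vectors pi H = [set 0].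

(* The infimum is taken in the extended reals, so that it is +oo when G has   *)
(* no infinite cyclic subgroup.                                               *)
Definition cyclic_escape (R : realType) (G : groupType) : Prop :=
  forall (V : hilbert R) (pi : unitary_rep G V), totally_ergodic_rep pi ->
  forall v : V,
    ereal_inf [set (hnorm (orth_proj (fixed_vectors pi C) v))%:E | C in
      [set C : set G | cyclic_subgroup C /\ infinite_set C]] = 0%E.

Record pmp_action (R : realType) (G : groupType) (d : measure_display)
    (X : measurableType d) (mu : probability X R) := PmpAction {
  act_fun :> G -> X -> X ;
  act1 : forall x : X, act_fun 1%g x = x ;
  actM : forall (g h : G) (x : X), act_fun (g * h)%g x = act_fun g (act_fun h x) ;
  act_measurable : forall g : G, measurable_fun setT (act_fun g) ;
  act_measure : forall (g : G) (A : set X), measurable A ->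
    mu (act_fun g @^-1` A) = mu A }.

Definition ergodic_on (R : realType) (G : groupType) (d : measure_display)
    (X : measurableType d) (mu : probability X R) (a : pmp_action G mu)
    (H : set G) : Prop :=
  forall A : set X, measurable A -> (forall h : G, H h -> a h @` A = A) ->
    mu A = 0%E \/ mu A = 1%E.

Definition totally_ergodic_action (R : realType) (G : groupType)
    (d : measure_display) (X : measurableType d) (mu : probability X R)
    (a : pmp_action G mu) : Prop :=
  forall H : set G, subgroup H -> finite_index H -> ergodic_on a H.

Definition directionally_expansive (R : realType) (G : groupType)
    (d : measure_display) (X : measurableType d) (mu : probability X R)
    (a : pmp_action G mu) : Prop :=
  forall B : set X, measurable B -> (0 < mu B)%E ->
  forall eps : R, 0 < eps ->
  exists2 C : set G, cyclic_subgroup C &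
    ((1 - eps)%:E < mu (\bigcup_(c in C) (a c @` B)))%E.

(* Main.v *)
Require Import Defs.
From HB Require Import structures.
From mathcomp Require Import all_boot all_order all_algebra.
From mathcomp Require Import complex ring lra.
From mathcomp Require Import all_classical all_reals all_analysis.
From mathcomp Require Import measurable_realfun.

Set Implicit Arguments.
Unset Strict Implicit.
Unset Printing Implicit Defensive.

Import Order.TTheory GRing.Theory Num.Theory.
Import numFieldNormedType.Exports.

Local Open Scope classical_set_scope.
Local Open Scope ring_scope.

(** The Koopman representation of an action on centered square-integrable
    functions carries the whole argument.

    Let B have positive measure, let C be a cyclic subgroup and let Y = CB.
    The function 1_Y - mu(Y) is fixed by C and, as B is contained in Y, its
    inner product with v = 1_B - mu(B) is mu(B) (1 - mu(Y)).  This inner product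
    does not change when v is replaced by its projection on the vectors fixed
    by C, and 1_Y - mu(Y) has norm at most 1; by Cauchy-Schwarz,
    mu(B) (1 - mu(Y)) <= |P_C v|.  If the Koopman representation is totally
    ergodic, the cyclic escape property provides an infinite cyclic C for which
    the right-hand side is below eps * mu(B), hence mu(Y) > 1 - eps.

    The representation is totally ergodic because a square-integrable
    function f that is almost everywhere invariant under a countable group H
    has superlevel sets that agree almost everywhere with strictly
    H-invariant sets, namely with the set of points whose whole H-orbit lies
    in the superlevel set. When H acts ergodically, the superlevel set at
    the mean of f is null or conull, so f - E f has a constant sign almost
    everywhere; its integral vanishes, so f is almost everywhere constant
    ([ergodic_ae_constant]).

    It remains to build the representation on an actual complex Hilbert space.
    The covariance is a semi-inner product on L2 whose kernel consists of the
    constants, so L2 with the covariance plays the role of the space of centered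
    functions.  Any complete real semi-inner product space E with form B yields
    a complex Hilbert space without passing to a quotient: its vectors are the
    functionals h |-> B f h + i B g h on E ([hspace]).  Completeness for the
    covariance is the Riesz-Fischer theorem ([sqint_L2lim], [cov_complete]), and
    the projections on spaces of fixed vectors come from the projection theorem
    for closed subspaces ([orth_projP]). *)

(** * Orthogonal projections in a Hilbert space *)

Section dot_product.
Variables (C : numClosedFieldType) (U : lmodType C) (form : {dot U for Num.conj}).

Local Notation "''[' u , v ]" := (form u%R v%R) : ring_scope.
Local Notation "''[' u ]" := '[u, u]%R : ring_scope.

(** Pythagoras for u, split into its component a v along v and a remainder w
    orthogonal to v. *)
Lemma dot_cauchy_schwarz u v : `|'[u, v]| ^+ 2 <= '[u] * '[v].
Proof.
have [->|v0] := eqVneq v 0; first by rewrite !linear0r normr0 expr0n.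
have v_gt0 : 0 < '[v] by rewrite dnorm_gt0.
pose a := '[u, v] / '[v]; pose w := u - a *: v.
have ow : '[w, a *: v] = 0.
  rewrite linearZr_LR/= linearBl/= linearZl_LR/=.
  by rewrite divfK ?gt_eqF// subrr mulr0.
have -> : '[u] = '[w] + `|a| ^+ 2 * '[v].
  by rewrite -dnormZ -hnormDd// subrK.
rewrite mulrDl -mulrA -expr2 -exprMn -{2}(ger0_norm (ltW v_gt0)) -normrM.
by rewrite divfK ?gt_eqF// lerDr mulr_ge0 ?dnorm_ge0.
Qed.

Lemma sqrt_dnorm_triangle u v :
  sqrtC '[u + v] <= sqrtC '[u] + sqrtC '[v].
Proof.
rewrite -ler_sqr ?nnegrE ?addr_ge0 ?sqrtC_ge0 ?dnorm_ge0//.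
rewrite sqrrD !sqrtCK addrAC dnormD lerD2l.
rewrite -mulr_natr -[_ + _](divfK (negbT (pnatr_eq0 C 2))) -ReE.
rewrite ler_pM2r ?ltr0n//.
apply: (le_trans (leif_Re_Creal '[u, v])).
rewrite -ler_sqr ?nnegrE ?mulr_ge0 ?sqrtC_ge0 ?dnorm_ge0//.
by rewrite exprMn !sqrtCK dot_cauchy_schwarz.
Qed.

End dot_product.

Section hilbert_norm.
Local Open Scope complex_scope.
Variables (R : realType) (V : hilbert R).
Implicit Types u v w : V.

Lemma realC_inj (x y : R) : x%:C = y%:C -> x = y.
Proof. by case. Qed.

Lemma realCD (x y : R) : (x + y)%:C = x%:C + y%:C.
Proof. by simpc. Qed.

Lemma realCM (x y : R) : (x * y)%:C = x%:C * y%:C.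
Proof. by simpc. Qed.

Lemma norm_hnorm v : `|v| = (hnorm v)%:C.
Proof. by rewrite /hnorm RRe_real// ger0_real. Qed.

Lemma hdot_sqr v : hdot V v v = (hnorm v ^+ 2)%:C.
Proof. by rewrite hdotE norm_hnorm rmorphXn. Qed.

Lemma hnorm_ge0 v : 0 <= hnorm v.
Proof. by rewrite -lecR -norm_hnorm normr_ge0. Qed.

Lemma hnorm0_eq0 v : hnorm v = 0 -> v = 0.
Proof. by move=> v0; apply/normr0_eq0; rewrite norm_hnorm v0. Qed.

Lemma hnorm_opp v : hnorm (- v) = hnorm v.
Proof. by rewrite /hnorm normrN. Qed.

Lemma hnormZ (a : R) v : 0 <= a -> hnorm (a%:C *: v) = a * hnorm v.
Proof.
move=> a0; apply: realC_inj; rewrite -norm_hnorm normrZ norm_hnorm rmorphM/=.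
by rewrite ger0_norm// ler0c.
Qed.

Lemma hnorm_triangle u v : hnorm (u + v) <= hnorm u + hnorm v.
Proof. by rewrite -lecR rmorphD/= -!norm_hnorm ler_normD. Qed.

Lemma hdot_le_hnorm u v : `|hdot V u v| <= (hnorm u * hnorm v)%:C.
Proof.
rewrite -ler_sqr ?nnegrE ?normr_ge0 ?ler0c ?mulr_ge0 ?hnorm_ge0//.
apply: (le_trans (dot_cauchy_schwarz _ _ _)).
by rewrite !hdot_sqr -rmorphM/= -rmorphXn/= exprMn.
Qed.

Lemma parallelogram u v :
  hnorm (u + v) ^+ 2 + hnorm (u - v) ^+ 2 = 2 * (hnorm u ^+ 2 + hnorm v ^+ 2).
Proof.
apply: realC_inj; rewrite [RHS]realCM !realCD -!hdot_sqr.
by rewrite dnormD dnormB; ring.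
Qed.

(** Completeness for sequences and real radii, so that the minimization below
    never has to mention filters or complex-valued distances. *)
Lemma hilbert_complete (w : nat -> V) :
  (forall e : R, 0 < e -> exists N, forall n, (N <= n)%N ->
     hnorm (w N - w n) < e) ->
  exists l, forall e : R, 0 < e -> exists N, forall n, (N <= n)%N ->
     hnorm (l - w n) < e.
Proof.
move=> cw.
have lim_w : cvg (w @ \oo).
  apply: cauchy_cvg; apply: cauchy_exP => e e0.
  have eE : e = (complex.Re e)%:C by rewrite RRe_real// ger0_real// ltW.
  have [N hN] := cw (complex.Re e) ltac:(by rewrite -ltcR -eE).
  exists (w N), N => //= n Nn.
  by rewrite -ball_normE/= eE norm_hnorm ltcR; exact: hN.
exists (lim (w @ \oo)) => e e0.
have : \forall n \near \oo, `|lim (w @ \oo) - w n| < e%:C.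
  by move/cvgrPdist_lt : lim_w; apply; rewrite ltcR.
case=> N _ hN; exists N => n Nn.
by rewrite -ltcR -norm_hnorm; exact: hN.
Qed.

End hilbert_norm.

Lemma sqr_addr_le (R : realFieldType) (x y : R) : 0 <= y -> y <= 1 ->
  (x + y) ^+ 2 <= x ^+ 2 + (2 * x + 1) * y.
Proof. by move=> y0 y1; have := ler_piMl y0 y1; lra. Qed.

Section projection.
Local Open Scope complex_scope.
Variables (R : realType) (V : hilbert R) (W : set V).
Hypothesis W0 : W 0.
Hypothesis W_lin : forall (a : R[i]) u w, W u -> W w -> W (a *: u + w).
Hypothesis W_closed : forall l : V,
  (forall e : R, 0 < e -> exists2 w, W w & hnorm (l - w) < e) -> W l.

Let W_mid u w : W u -> W w -> W (2^-1 *: (u + w)).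
Proof.
move=> Wu Ww; rewrite scalerDr.
by apply: W_lin => //; rewrite -[_ *: w]addr0; exact: W_lin.
Qed.

(** A minimizing sequence is Cauchy, by the parallelogram law, and its limit
    attains the distance from v to W. *)
Lemma nearest_vector_exists v :
  exists2 p, W p & forall w, W w -> hnorm (v - p) <= hnorm (v - w).
Proof.
pose D := [set hnorm (v - w) | w in W].
have D_inf : has_inf D.
  split; first by exists (hnorm (v - 0)), 0.
  by exists 0 => _ [w _ <-]; exact: hnorm_ge0.
pose dist : R := inf D.
have dist_le w : W w -> dist <= hnorm (v - w).
  by move=> Ww; apply: (ge_inf D_inf.2); exists w.
have dist_ge0 : 0 <= dist.
  by apply: lb_le_inf D_inf.1 _ => _ [w _ <-]; exact: hnorm_ge0.
have approx n : {w | W w & hnorm (v - w) < dist + n.+1%:R^-1}.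
  apply/cid2; have [//|_ [w Ww <-] ?] := @inf_adherent _ D n.+1%:R^-1 _ D_inf.
  by exists w.
pose w n := s2val (approx n).
have Ww n : W (w n) by rewrite /w; case: (approx n).
have w_lt n : hnorm (v - w n) < dist + n.+1%:R^-1.
  by rewrite /w; case: (approx n).
(* The midpoint of two almost nearest vectors is no nearer than dist, so the
   parallelogram law forces the two vectors to be close to each other. *)
have close n m : (n <= m)%N ->
    hnorm (w n - w m) ^+ 2 <= 4 * (2 * dist + 1) * n.+1%:R^-1.
  move=> nm.
  have := parallelogram (v - w n) (v - w m).
  have -> : v - w n - (v - w m) = - (w n - w m) by rewrite !opprB addrC addrA subrK.
  rewrite hnorm_opp => par.
  have mid : 4 * dist ^+ 2 <= hnorm (v - w n + (v - w m)) ^+ 2.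
    have -> : v - w n + (v - w m) = 2%:R%:C *: (v - 2^-1 *: (w n + w m)).
      have -> : 2%:R%:C = 2 :> R[i] by rewrite rmorph_nat.
      by rewrite scalerBr scalerA divff// scale1r scaler_nat mulr2n opprD addrACA.
    rewrite hnormZ// exprMn -natrX ler_pM2l// ler_sqr ?nnegrE ?hnorm_ge0//.
    by apply: dist_le; exact: W_mid.
  have le_n k : (n <= k)%N ->
      hnorm (v - w k) ^+ 2 <= dist ^+ 2 + (2 * dist + 1) * n.+1%:R^-1.
    move=> nk.
    have h1 : hnorm (v - w k) <= dist + n.+1%:R^-1.
      by apply: (le_trans (ltW (w_lt k))); rewrite lerD2l lef_pV2 ?posrE// ler_nat.
    have h2 : n.+1%:R^-1 <= 1 :> R by rewrite invf_le1// ler1n.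
    have h3 : 0 <= n.+1%:R^-1 :> R by rewrite invr_ge0.
    have h4 : hnorm (v - w k) ^+ 2 <= (dist + n.+1%:R^-1) ^+ 2.
      by rewrite ler_sqr// nnegrE ?hnorm_ge0// addr_ge0.
    exact/(le_trans h4)/sqr_addr_le.
  have := le_n n (leqnn n); have := le_n m nm; rewrite -mulrA.
  move: (_ / _) (dist ^+ 2) mid par.
  by move: (_ ^+ 2) (_ ^+ 2) (_ ^+ 2) (_ ^+ 2); clear; move=> *; lra.
have [p hp] : exists l, forall e : R, 0 < e -> exists N, forall n, (N <= n)%N ->
    hnorm (l - w n) < e.
  apply: hilbert_complete => e e0.
  pose K : R := 4 * (2 * dist + 1) / e ^+ 2.
  have K_gt0 : 0 < K by rewrite divr_gt0 ?exprn_gt0//; nra.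
  exists (Num.truncn K) => n hn; rewrite -ltr_sqr ?nnegrE ?hnorm_ge0 ?ltW//.
  apply: (le_lt_trans (close _ _ hn)).
  rewrite ltr_pdivrMr// [ltRHS]mulrC -ltr_pdivrMr ?exprn_gt0//.
  exact: truncnS_gt.
exists p.
  apply: W_closed => e e0; have [N hN] := hp e e0.
  by exists (w N) => //; exact: hN.
move=> u Wu; apply: le_trans (dist_le _ Wu).
apply/ler_addgt0Pr => e e0.
have e2 : 0 < e / 2 by rewrite divr_gt0.
have [N hN] := hp _ e2.
pose M := (N + Num.truncn (e / 2)^-1)%N.
have -> : v - p = (v - w M) - (p - w M) by rewrite opprB addrA subrK.
apply: le_trans (hnorm_triangle _ _) _; rewrite hnorm_opp.
have h1 : hnorm (p - w M) < e / 2 by apply: hN; rewrite leq_addr.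
have h2 : hnorm (v - w M) <= dist + e / 2.
  apply: (le_trans (ltW (w_lt M))); rewrite lerD2l -[e / 2]invrK lef_pV2 ?posrE ?invr_gt0//.
  apply: ltW; apply: lt_le_trans (truncnS_gt _) _.
  by rewrite ler_nat ltnS leq_addl.
lra.
Qed.

(** If v - p had a component t u along W, then moving p by t u would bring it
    strictly closer to v. *)
Lemma nearest_vector_orthogonal v p : W p ->
    (forall w, W w -> hnorm (v - p) <= hnorm (v - w)) ->
  forall u, W u -> hdot V (v - p) u = 0.
Proof.
move=> Wp p_min u Wu.
have [->|u0] := eqVneq u 0; first by rewrite linear0r.
have u_gt0 : 0 < hdot V u u by rewrite dnorm_gt0.
set c := hdot V (v - p) u; pose t := c / hdot V u u.
have ow : hdot V (v - (t *: u + p)) (t *: u) = 0.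
  rewrite linearZr_LR/= opprD addrCA addrC linearBl/= linearZl_LR/=.
  by rewrite divfK ?gt_eqF// subrr mulr0.
have := p_min _ (W_lin t Wu Wp).
rewrite -ler_sqr ?nnegrE ?hnorm_ge0// -lecR -!hdot_sqr.
have -> : v - p = (v - (t *: u + p)) + t *: u.
  by rewrite opprD addrA addrAC addrNK.
rewrite (hnormDd ow) gerDl => tu0.
have : `|t| ^+ 2 * hdot V u u <= 0 by rewrite -dnormZ.
rewrite pmulr_lle0// => t0.
have : t = 0 by apply/eqP; rewrite -normr_eq0 -sqrf_eq0 eq_le t0 exprn_ge0.
by move/eqP; rewrite mulf_eq0 invr_eq0 (gt_eqF u_gt0) orbF => /eqP.
Qed.

(** Projection theorem: the default value in the definition of [orth_proj] is
    not taken. *)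
Lemma orth_projP v :
  W (orth_proj W v) /\ forall u, W u -> hdot V (v - orth_proj W v) u = 0.
Proof.
have [p Wp p_min] := nearest_vector_exists v.
rewrite /orth_proj; apply: (@xgetPex _ 0 [set w | W w /\ _]); exists p.
by split=> // u; exact: nearest_vector_orthogonal.
Qed.

End projection.

Section fixed_vectors.
Variables (R : realType) (G : groupType) (V : hilbert R) (pi : unitary_rep G V).

Lemma hnorm_rep g v : hnorm (pi g v) = hnorm v.
Proof.
have := rep_dot pi g v v; rewrite !hdot_sqr => /realC_inj/eqP.
by rewrite eqrXn2 ?hnorm_ge0// => /eqP.
Qed.

(** Unitary operators are isometries, so a limit of fixed vectors is fixed. *)
Lemma orth_proj_fixedP (H : set G) v (W := fixed_vectors pi H) :
  W (orth_proj W v) /\ forall u, W u -> hdot V (v - orth_proj W v) u = 0.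
Proof.
apply: orth_projP => [h _|c u w Wu Ww h Hh|l l_lim h Hh]; first exact: linear0.
  by rewrite linearP Wu// Ww.
apply/eqP; rewrite -subr_eq0; apply/eqP/hnorm0_eq0/eqP.
rewrite eq_le hnorm_ge0 andbT; apply/ler_addgt0Pr => e e0; rewrite add0r.
have [w Ww lw] := l_lim (e / 2) ltac:(by rewrite divr_gt0).
have -> : pi h l - l = pi h (l - w) - (l - w).
  by rewrite linearB/= (Ww h Hh) opprB addrA subrK.
apply: (le_trans (hnorm_triangle _ _)); rewrite hnorm_opp hnorm_rep.
lra.
Qed.

(** A fixed vector sees only the projection of v, and Cauchy-Schwarz bounds
    what it sees: this is how a small projection is exploited. *)
Lemma hdot_fixed_le (H : set G) v u : fixed_vectors pi H u ->
  `|hdot V v u| <=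
    real_complex R (hnorm (orth_proj (fixed_vectors pi H) v) * hnorm u).
Proof.
move=> Wu; have [_ /(_ u Wu)] := orth_proj_fixedP H v.
rewrite linearBl/= => /eqP; rewrite subr_eq0 => /eqP ->.
exact: hdot_le_hnorm.
Qed.

End fixed_vectors.

(** * The Hilbert space of a complete semi-inner product *)

(** The form is only semi-definite: vectors of norm zero need not vanish.
    Completeness is asked of sequences with increments at most 2^-n in norm,
    which suffices because every Cauchy filter yields such a sequence. *)
Record prehilbert (R : realType) := PreHilbert {
  prehilbert_sort :> lmodType R ;
  pform : prehilbert_sort -> prehilbert_sort -> R ;
  pformC : forall f g, pform f g = pform g f ;
  pformDl : forall f g h, pform (f + g) h = pform f h + pform g h ;
  pformZl : forall a f g, pform (a *: f) g = a * pform f g ;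
  pform_ge0 : forall f, 0 <= pform f f ;
  pform_complete : forall u : nat -> prehilbert_sort,
    (forall n, pform (u n.+1 - u n) (u n.+1 - u n) <= (2^-1 ^+ n) ^+ 2) ->
    exists l, forall e : R, 0 < e -> exists N, forall n, (N <= n)%N ->
      pform (u n - l) (u n - l) < e }.

Section hspace.
Local Open Scope complex_scope.
Variables (R : realType) (E : prehilbert R).
Local Notation B := (@pform R E).

Lemma pformNl f g : B (- f) g = - B f g.
Proof. by rewrite -scaleN1r pformZl mulN1r. Qed.
Lemma pformBl f g h : B (f - g) h = B f h - B g h.
Proof. by rewrite pformDl pformNl. Qed.
Lemma pformDr f g h : B f (g + h) = B f g + B f h.
Proof. by rewrite !(pformC f) pformDl. Qed.
Lemma pformZr a f g : B f (a *: g) = a * B f g.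
Proof. by rewrite !(pformC f) pformZl. Qed.
Lemma pform0l g : B 0 g = 0.
Proof. by rewrite -(scale0r 0) pformZl mul0r. Qed.

(** Otherwise t |-> B (t f + h) (t f + h) would be a nonconstant affine
    function of t, and take negative values. *)
Lemma pform_null f h : B f f = 0 -> B f h = 0.
Proof.
move=> f0; apply/eqP/negPn/negP => fh0.
pose t := - (B h h + 1) / (2 * B f h).
have := pform_ge0 (t *: f + h).
rewrite pformDl !pformDr !pformZl !pformZr f0 !mulr0 add0r (pformC h f).
have -> : t * B f h = - (B h h + 1) / 2 by rewrite /t; field.
lra.
Qed.

(** The real and imaginary parts f and g of a vector of the complexification
    enter only through their pairings with E, hence only modulo the kernel of
    the form. *)
Definition pairing (f g h : E) : R[i] := B f h +i* B g h.

Definition representable : {pred E -> R[i]^o} :=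
  mem [set phi | exists f g, phi = pairing f g].

(** A submodule of the complex functions on E, isomorphic to the
    complexification of E modulo the kernel of its form. *)
Record hspace := Hspace { hval :> E -> R[i]^o ; _ : hval \in representable }.
HB.instance Definition _ := [isSub for hval].
HB.instance Definition _ := [Choice of hspace by <:].

Lemma representable_submod : submod_closed representable.
Proof.
split; first by rewrite inE/=; exists 0, 0; apply/funext => h; rewrite /pairing !pform0l.
move=> [a b] phi psi /[!inE]/= -[f [g ->]] [f' [g' ->]].
exists (a *: f - b *: g + f'), (b *: f + a *: g + g'); apply/funext => h.
rewrite /pairing fctE/= /GRing.scale/=.
by rewrite !(pformDl, pformNl, pformZl); simpc; congr (_ +i* _); ring.
Qed.
HB.instance Definition _ := GRing.isSubmodClosed.Build _ _ representable
  representable_submod.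
HB.instance Definition _ := [SubChoice_isSubLmodule of hspace by <:].

Lemma embed_subproof (f : E * E) : (pairing f.1 f.2 : E -> R[i]^o) \in representable.
Proof. by rewrite inE; exists f.1, f.2. Qed.
Definition hpair (f g : E) : hspace := Hspace (embed_subproof (f, g)).

Lemma hpair_ex (phi : hspace) : {fg : E * E | phi = hpair fg.1 fg.2}.
Proof.
apply/cid; case: phi => phi /[dup]; rewrite {1}inE => -[f [g phiE]] rphi.
by exists (f, g); apply/val_inj.
Qed.
(** Representatives are chosen arbitrarily; they are unique only modulo the
    kernel of the form, see [hre_pair] and [him_pair]. *)
Definition hre phi := (sval (hpair_ex phi)).1.
Definition him phi := (sval (hpair_ex phi)).2.
Lemma hpairK phi : hpair (hre phi) (him phi) = phi.
Proof. by rewrite -(svalP (hpair_ex phi)). Qed.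

Lemma hre_pair f g h : B (hre (hpair f g)) h = B f h.
Proof. by have /(congr1 (fun phi : hspace => complex.Re (phi h))) := hpairK (hpair f g). Qed.
Lemma him_pair f g h : B (him (hpair f g)) h = B g h.
Proof. by have /(congr1 (fun phi : hspace => complex.Im (phi h))) := hpairK (hpair f g). Qed.

Lemma hpairB f g f' g' : hpair f g - hpair f' g' = hpair (f - f') (g - g').
Proof.
apply/val_inj/funext => h /=; rewrite !fctE/= /pairing !pformBl.
by simpc.
Qed.

(** For psi represented by f' and g', this is phi, extended linearly, at
    f' - i g', so that linearity in phi holds by definition.  [hspace_dotE] gives
    the usual formula in terms of the representatives. *)
Definition hspace_dot (phi psi : hspace) : R[i] :=
  phi (hre psi) - 'i * phi (him psi).

Lemma hspace_dotE f g f' g' : hspace_dot (hpair f g) (hpair f' g') =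
  (B f f' + B g g') +i* (B g f' - B f g').
Proof.
rewrite /hspace_dot/= /pairing !(pformC _ (hre _)) !(pformC _ (him _)).
rewrite !hre_pair !him_pair !(pformC f') !(pformC g').
by simpc; congr (_ +i* _); ring.
Qed.

Lemma hspace_dot_hermitian phi psi :
  hspace_dot phi psi = (-1) ^+ false * (hspace_dot psi phi)^*.
Proof.
rewrite expr0 mul1r -(hpairK phi) -(hpairK psi) !hspace_dotE /=.
by rewrite !(pformC (hre psi)) !(pformC (him psi)); congr (_ +i* _); ring.
Qed.

Lemma hspace_dotDl phi psi xi :
  hspace_dot (phi + psi) xi = hspace_dot phi xi + hspace_dot psi xi.
Proof. by rewrite /hspace_dot/= !fctE; ring. Qed.

Lemma hspace_dotZl a phi psi : hspace_dot (a *: phi) psi = a * hspace_dot phi psi.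
Proof. by rewrite /hspace_dot/= !fctE /GRing.scale/=; ring. Qed.

Let dot_zmodl u : zmod_morphism (hspace_dot^~ u).
Proof.
by move=> x y; rewrite hspace_dotDl -scaleN1r hspace_dotZl mulN1r.
Qed.
Let dot_scall u : scalable_for *%R (hspace_dot^~ u).
Proof. by move=> a x; rewrite hspace_dotZl. Qed.
Let dot_zmodr u : zmod_morphism (hspace_dot u).
Proof.
move=> x y; rewrite !(hspace_dot_hermitian u) dot_zmodl.
by rewrite !expr0 !mul1r rmorphB.
Qed.
Let dot_scalr u : scalable_for (Num.conj \; *%R) (hspace_dot u).
Proof.
move=> a x; rewrite !(hspace_dot_hermitian u) dot_scall.
by rewrite !expr0 !mul1r rmorphM.
Qed.
HB.instance Definition _ := @isBilinear.Build R[i] hspace hspace R[i]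
  ( *%R ) (Num.conj \; *%R) hspace_dot dot_zmodl dot_zmodr dot_scall dot_scalr.
HB.instance Definition _ := @isHermitianSesquilinear.Build R[i] hspace false
  Num.conj hspace_dot hspace_dot_hermitian.

Lemma hspace_dot_sqr f g : hspace_dot (hpair f g) (hpair f g) = (B f f + B g g)%:C.
Proof. by rewrite hspace_dotE (pformC g f) subrr. Qed.

Let dot_gt0 phi : phi != 0 -> 0 < hspace_dot phi phi.
Proof.
rewrite -(hpairK phi); move: (hre phi) (him phi) => f g fg0.
rewrite hspace_dot_sqr ltcR lt_def addr_ge0 ?pform_ge0// andbT.
apply: contra fg0; rewrite paddr_eq0 ?pform_ge0// => /andP[/eqP f0 /eqP g0].
have fg_null : pairing f g = 0 :> (E -> R[i]^o).
  by apply/funext => h; rewrite /pairing (pform_null h f0) (pform_null h g0).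
by apply/eqP/val_inj.
Qed.
HB.instance Definition _ := isDotProduct.Build R[i] hspace hspace_dot dot_gt0.

Definition hspace_norm phi : R[i] := sqrtC (hspace_dot phi phi).

Let normD phi psi : hspace_norm (phi + psi) <= hspace_norm phi + hspace_norm psi.
Proof. exact: (sqrt_dnorm_triangle hspace_dot). Qed.

Let normZ a phi : hspace_norm (a *: phi) = `|a| * hspace_norm phi.
Proof.
by rewrite /hspace_norm (dnormZ hspace_dot) sqrtCM ?nnegrE ?exprn_ge0 ?sqrCK//.
Qed.

Let norm0_eq0 phi : hspace_norm phi = 0 -> phi = 0.
Proof. by move/eqP; rewrite (sqrt_dnorm_eq0 hspace_dot) => /eqP. Qed.

HB.instance Definition _ := Lmodule_isNormed.Build R[i] hspace normD normZ norm0_eq0.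

Lemma hspace_normE (phi : hspace) : hspace_dot phi phi = `|phi| ^+ 2.
Proof. by rewrite (_ : `|phi| = hspace_norm phi)// sqrtCK. Qed.

Lemma sqr_norm_hpair f g : `|hpair f g| ^+ 2 = (B f f + B g g)%:C.
Proof. by rewrite -hspace_normE hspace_dot_sqr. Qed.

(** A Cauchy filter concentrates on balls of radius 2^-(n+1); their centers form
    a fast Cauchy sequence, and so do the real and imaginary parts of the
    centers.  The limits of the two parts give the limit of the filter. *)
Lemma hspace_cauchy_cvg (F : set_system hspace) :
  ProperFilter F -> cauchy F -> cvg F.
Proof.
move=> FF /cauchyP F_cauchy.
pose r n : R := 2^-1 ^+ n.+1.
have r_gt0 n : 0 < r n by rewrite exprn_gt0.
have /choice[u uP] n : exists phi : hspace, F (ball phi (r n)%:C).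
  by apply: F_cauchy; rewrite ltcR.
have u_close n : `|u n.+1 - u n| < (2^-1 ^+ n)%:C.
  have [x [/= xn xSn]] := filter_ex (filterI (uP n) (uP n.+1)).
  move: xn xSn; rewrite -!ball_normE/= => xn xSn.
  have -> : u n.+1 - u n = (u n.+1 - x) - (u n - x).
    by rewrite opprB addrA subrK.
  apply: (le_lt_trans (ler_normB _ _)); apply: (lt_le_trans (ltrD xSn xn)).
  rewrite -realCD lecR /r [2^-1 ^+ n.+2]exprS exprS.
  have : 0 <= 2^-1 ^+ n :> R by rewrite exprn_ge0.
  lra.
have u_dist n f g : `|u n - hpair f g| ^+ 2 =
    (B (hre (u n) - f) (hre (u n) - f) + B (him (u n) - g) (him (u n) - g))%:C.
  by rewrite -{1}(hpairK (u n)) hpairB sqr_norm_hpair.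
have u_close_sqr n : B (hre (u n.+1) - hre (u n)) (hre (u n.+1) - hre (u n)) +
    B (him (u n.+1) - him (u n)) (him (u n.+1) - him (u n)) <= (2^-1 ^+ n) ^+ 2.
  rewrite -lecR -u_dist hpairK -[leRHS]/((real_complex R) _) rmorphXn/=.
  by rewrite ler_sqr ?nnegrE ?normr_ge0 ?ler0c ?exprn_ge0// ltW.
have [f hf] := @pform_complete _ E (fun n => hre (u n)) (fun n =>
  le_trans (ler_wpDr (pform_ge0 _) (lexx _)) (u_close_sqr n)).
have [g hg] := @pform_complete _ E (fun n => him (u n)) (fun n =>
  le_trans (ler_wpDl (pform_ge0 _) (lexx _)) (u_close_sqr n)).
apply/cvg_ex; exists (hpair f g); apply/fcvgrPdist_lt => e e0.
have eE : e = (complex.Re e)%:C by rewrite RRe_real// ger0_real// ltW.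
have {}e0 : 0 < complex.Re e by rewrite -ltcR -eE.
move: (complex.Re e) eE e0 => {}e -> e0.
have d_gt0 : 0 < (e / 2) ^+ 2 / 2 by rewrite divr_gt0// exprn_gt0// divr_gt0.
have [N hN] := hf _ d_gt0; have [M hM] := hg _ d_gt0.
have [K hK] : exists K, r K < e / 2.
  have half_lt1 : `|2^-1 : R| < 1 by rewrite ger0_norm ?invr_ge0// invf_lt1// ltr1n.
  have /cvgr0Pnorm_lt/(_ (e / 2)) := cvg_expr half_lt1.
  case; [by rewrite divr_gt0|move=> K _ hK; exists K].
  have := hK K.+1 (leqnSn K); rewrite /= ger0_norm ?exprn_ge0//.
pose n := (N + M + K)%N.
have rn : r n <= r K.
  by rewrite ler_wiXn2l// ?invr_ge0// ?invf_le1// ?ler1n// ltnS leq_addl.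
have un : `|hpair f g - u n| < (e / 2)%:C.
  rewrite distrC -ltr_sqr ?nnegrE ?normr_ge0 ?ler0c ?divr_ge0 ?ltW//.
  rewrite u_dist -rmorphXn/= ltcR.
  have Nn : (N <= n)%N by rewrite /n -addnA leq_addr.
  have Mn : (M <= n)%N by rewrite /n addnAC leq_addl.
  have := hN n Nn; have := hM n Mn; lra.
near=> x.
have -> : hpair f g - x = (hpair f g - u n) + (u n - x) by rewrite addrA subrK.
apply: (le_lt_trans (ler_normD _ _)).
have -> : e%:C = (e / 2)%:C + (e / 2)%:C by rewrite -realCD -splitr.
apply: ltrD => //; apply: (@lt_trans _ _ (r n)%:C); last first.
  by rewrite ltcR (le_lt_trans rn).
near: x; have := uP n; rewrite -ball_normE; exact.
Unshelve. all: by end_near. Qed.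

HB.instance Definition _ := Uniform_isComplete.Build hspace hspace_cauchy_cvg.

Definition hspace_hilbert : hilbert R :=
  @Hilbert R hspace hspace_dot hspace_normE.

End hspace.

(** An isometric group action on E becomes a unitary representation by
    precomposition with T g^-1, which is linear in the functional; by invariance
    of the form this amounts to applying T g to the representatives. *)
Section hspace_rep.
Variables (R : realType) (G : groupType) (E : prehilbert R) (T : G -> E -> E).
Hypothesis T1 : forall f, T 1%g f = f.
Hypothesis TM : forall g h f, T (g * h)%g f = T g (T h f).
Hypothesis T_iso : forall g f f', pform (T g f) (T g f') = pform f f'.

Lemma pform_adjoint g f h : pform f (T g^-1%g h) = pform (T g f) h.
Proof. by rewrite -[h in RHS]T1 -(mulgV g) TM T_iso. Qed.

Lemma hspace_act_subproof g (phi : hspace E) :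
  (fun h => phi (T g^-1%g h) : R[i]^o) \in representable (E := E).
Proof.
rewrite inE -(hpairK phi); exists (T g (hre phi)), (T g (him phi)).
by apply/funext => h; rewrite /= /pairing !pform_adjoint.
Qed.
Definition hspace_act g (phi : hspace_hilbert E) : hspace_hilbert E :=
  Hspace (hspace_act_subproof g phi).

Lemma hspace_act_pair g f f' :
  hspace_act g (hpair f f') = hpair (T g f) (T g f').
Proof. by apply/val_inj/funext => h; rewrite /= /pairing !pform_adjoint. Qed.

Lemma hspace_act_linear g : linear (hspace_act g).
Proof. by move=> a phi psi; exact/val_inj/funext. Qed.
HB.instance Definition _ g := GRing.isLinear.Build R[i] (hspace_hilbert E)
  (hspace_hilbert E) _ (hspace_act g) (hspace_act_linear g).

Lemma hspace_act1 phi : hspace_act 1%g phi = phi.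
Proof. by apply/val_inj/funext => h; rewrite /= invg1 T1. Qed.

Lemma hspace_actM g h phi :
  hspace_act (g * h)%g phi = hspace_act g (hspace_act h phi).
Proof. by apply/val_inj/funext => k; rewrite /= invgM TM. Qed.

Lemma hspace_act_dot g (phi psi : hspace_hilbert E) :
  hdot (hspace_hilbert E) (hspace_act g phi) (hspace_act g psi) =
  hdot (hspace_hilbert E) phi psi.
Proof.
rewrite -(hpairK phi) -(hpairK psi) !hspace_act_pair.
by rewrite /hdot/= !hspace_dotE !T_iso.
Qed.

Definition hspace_rep : unitary_rep G (hspace_hilbert E) :=
  @UnitaryRep R G (hspace_hilbert E) (fun g => hspace_act g)
    hspace_act1 hspace_actM hspace_act_dot.

End hspace_rep.

(** * Completeness of L2 *)

Section riesz_fischer.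
Context d (X : measurableType d) (R : realType) (mu : probability X R).
Implicit Types f g : X -> R.

(** The squared L2 norm, as an extended real so that it makes sense before
    square integrability is known. *)
Definition sqint f : \bar R := (\int[mu]_x (f x ^+ 2)%:E)%E.

Lemma measurable_sqr f : measurable_fun setT f ->
  measurable_fun [set: X] (fun x => (f x ^+ 2)%:E : \bar R).
Proof. by move=> mf; apply/measurable_EFinP; exact: measurable_funX. Qed.

Lemma sqr_ge0E f x : (0 <= (f x ^+ 2)%:E)%E.
Proof. by rewrite lee_fin sqr_ge0. Qed.

Lemma sqint_ge0 f : (0 <= sqint f)%E.
Proof. by apply: integral_ge0 => x _; exact: sqr_ge0E. Qed.

Lemma sqintD_le f g : measurable_fun setT f -> measurable_fun setT g ->
  (sqint (f \+ g)%R <= 2%:E * sqint f + 2%:E * sqint g)%E.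
Proof.
move=> mf mg; rewrite /sqint -!ge0_integralZl//; last 4 first.
- exact: measurable_sqr.
- by move=> x _; exact: sqr_ge0E.
- exact: measurable_sqr.
- by move=> x _; exact: sqr_ge0E.
rewrite -ge0_integralD//; last 4 first.
- by move=> x _; rewrite mule_ge0// sqr_ge0E.
- by apply: measurable_funeM; exact: measurable_sqr.
- by move=> x _; rewrite mule_ge0// sqr_ge0E.
- by apply: measurable_funeM; exact: measurable_sqr.
apply: ge0_le_integral => //.
- by move=> x _; exact: sqr_ge0E.
- by apply: measurable_sqr; exact: measurable_funD.
- by apply: emeasurable_funD; apply: measurable_funeM; exact: measurable_sqr.
- move=> x _; rewrite -!EFinM -EFinD lee_fin.
  have := sqr_ge0 (f x - g x); rewrite /=; lra.
Qed.

Lemma Lfun2P f : measurable_fun setT f -> (sqint f < +oo)%E -> f \in Lfun mu 2%:E.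
Proof.
move=> mf f_fin; rewrite inE; apply/andP; split; rewrite inE//=.
rewrite /finite_norm unlock poweR_lty//.
apply: le_lt_trans f_fin; rewrite le_eqVlt; apply/orP; left; apply/eqP.
apply: eq_integral => x _ /=.
by rewrite powR_mulrn// real_normK// num_real.
Qed.

Lemma Lfun_measurable f p : f \in Lfun mu p -> measurable_fun setT f.
Proof. by rewrite inE => /andP[/[!inE]]. Qed.

Variable w : nat -> X -> R.
Hypothesis mw : forall n, measurable_fun setT (w n).
Hypothesis w_close : forall n, (sqint (w n.+1 \- w n)%R <= ((2^-1 ^+ n) ^+ 2)%:E)%E.

Let mdiff m n : measurable_fun setT (w m \- w n).
Proof. exact: measurable_funB. Qed.

(** Because the squared increments decrease by a factor 4, the crude bound
    (x + y)^2 <= 2 x^2 + 2 y^2 is enough to sum them: 4 is a fixed point of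
    c |-> 2 + 2 (c / 4). *)
Lemma sqint_tail n k :
  (sqint (w (n + k)%N \- w n)%R <= (4 * (2^-1 ^+ n) ^+ 2)%:E)%E.
Proof.
elim: k n => [|k IH] n.
  rewrite addn0 /sqint (_ : (fun x => _) = cst 0%E); last first.
    by apply/funext => x /=; rewrite subrr expr0n.
  by rewrite integral_cst// mul0e lee_fin mulr_ge0// sqr_ge0.
have -> : w (n + k.+1) \- w n = (w (n.+1 + k) \- w n.+1) \+ (w n.+1 \- w n).
  by apply/funext => x /=; rewrite addnS addSn addrA subrK.
apply: (le_trans (sqintD_le (mdiff _ _) (mdiff _ _))).
apply: (@le_trans _ _ (2%:E * (4 * (2^-1 ^+ n.+1) ^+ 2)%:E +
  2%:E * ((2^-1 ^+ n) ^+ 2)%:E)%E).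
  by apply: leeD; apply: lee_pmul => //; exact: sqint_ge0.
rewrite -!EFinM -EFinD lee_fin [2^-1 ^+ n.+1]exprS exprMn.
have := sqr_ge0 (2^-1 ^+ n : R).
lra.
Qed.

Let D n x : R := `|w n.+1 x - w n x|.

Let measurable_D n : measurable_fun setT (D n).
Proof.
by apply: (@measurableT_comp _ _ _ _ _ _ (@Num.norm R R)) => //; exact: mdiff.
Qed.

Lemma int_diff_le n : (\int[mu]_x (D n x)%:E <= (2^-1 ^+ n)%:E)%E.
Proof.
have r_gt0 : 0 < 2^-1 ^+ n :> R by rewrite exprn_gt0.
set r : R := 2^-1 ^+ n in r_gt0 *.
(* On a probability space, Young's inequality y <= y^2 / (2 r) + r / 2 turns
   the bound r^2 on the square into the bound r on the integral. *)
have agm x : D n x <= (2 * r)^-1 * (w n.+1 \- w n) x ^+ 2 + r / 2.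
  rewrite /D /= -[in leRHS]real_normK ?num_real//.
  move: `|_| => y.
  have -> : (2 * r)^-1 * y ^+ 2 + r / 2 = y + (2 * r)^-1 * (y - r) ^+ 2.
    by field; rewrite gt_eqF.
  by rewrite lerDl mulr_ge0 ?sqr_ge0// invr_ge0 mulr_ge0// ltW.
apply: (@le_trans _ _ (\int[mu]_x (((2 * r)^-1)%:E * ((w n.+1 \- w n)%R x ^+ 2)%:E
   + (r / 2)%:E))%E).
  apply: ge0_le_integral => //.
  - by move=> x _; rewrite lee_fin normr_ge0.
  - exact/measurable_EFinP/measurable_D.
  - apply: emeasurable_funD => //; apply: measurable_funeM.
    exact: measurable_sqr.
  - by move=> x _; rewrite -EFinM -EFinD lee_fin agm.
have c_ge0 : (0 <= ((2 * r)^-1)%:E)%E.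
  by rewrite lee_fin invr_ge0 mulr_ge0// ltW.
rewrite ge0_integralD//; last 3 first.
- by move=> x _; rewrite mule_ge0// sqr_ge0E.
- by apply: measurable_funeM; exact: measurable_sqr.
- by move=> x _; rewrite lee_fin divr_ge0// ltW.
rewrite ge0_integralZl//; last 2 first.
- exact: measurable_sqr.
- by move=> x _; exact: sqr_ge0E.
rewrite integral_cst// [X in (_ + _ * X)%E]probability_setT mule1.
apply: (@le_trans _ _ (((2 * r)^-1)%:E * (r ^+ 2)%:E + (r / 2)%:E)%E).
  by rewrite leeD2r// lee_pmul2l// ?lte_fin ?invr_gt0 ?mulr_gt0//; exact: w_close.
rewrite -EFinM -EFinD lee_fin.
have -> : (2 * r)^-1 * r ^+ 2 + r / 2 = r by field; rewrite gt_eqF.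
exact: lexx.
Qed.

(** The expected total variation of the sequence is at most the sum of the
    2^-n, and a variable with finite expectation is almost surely finite. *)
Lemma ae_sum_diff_fin :
  {ae mu, forall x, (\sum_(0 <= n <oo) (D n x)%:E)%E \is a fin_num}.
Proof.
have mD n : measurable_fun setT (fun x => (D n x)%:E).
  exact/measurable_EFinP/measurable_D.
have D_ge0 n x : (0 <= (D n x)%:E)%E by rewrite lee_fin normr_ge0.
suff : mu.-integrable setT (fun x => \sum_(0 <= n <oo) (D n x)%:E)%E.
  by move/(integrable_ae measurableT); apply: filterS => x /(_ I).
apply/integrableP; split.
  apply: (@ge0_emeasurable_sum _ _ _ _ (fun n x => (D n x)%:E) xpredT) => //.
under eq_integral => x _.
  rewrite gee0_abs; last by apply: nneseries_ge0 => *; exact: D_ge0.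
  over.
rewrite /= integral_nneseries//.
apply: (@le_lt_trans _ _ (\sum_(0 <= n <oo) (2 / (2 ^ (n + 1))%:R : R)%:E)%E).
  apply: lee_nneseries => [n _ _|n _]; first exact: integral_ge0.
  apply: (le_trans (int_diff_le n)).
  by rewrite lee_fin addn1 expnS natrM invfM mulrA divff// mul1r exprVn natrX.
by rewrite (cvg_lim _ (@cvg_geometric_eseries_half R 2 0))// ltry.
Qed.

Lemma ae_cvg_seq : {ae mu, forall x, cvgn (w ^~ x)}.
Proof.
apply: filterS ae_sum_diff_fin => x Sfin.
have : cvgn (@series R (telescope (w ^~ x))).
  apply: normed_cvg; apply: nondecreasing_is_cvgn.
    by apply: nondecreasing_series => *; exact: normr_ge0.
  exists (fine (\sum_(0 <= n <oo) (D n x)%:E)%E) => _ [n _ <-].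
  rewrite -lee_fin fineK// /normed_series_of /series /= -sumEFin.
  by apply: nneseries_lim_ge => k _ _; rewrite lee_fin normr_ge0.
rewrite telescopeK => h.
have -> : w ^~ x = (fun n => w n x - w 0 x) + cst (w 0%N x).
  by apply/funext => n; rewrite /= fctE subrK.
exact: is_cvgD h (is_cvg_cst _).
Qed.

(** The upper limit is measurable whether or not the sequence converges, and
    is the limit wherever the sequence converges. *)
Definition L2lim x : R := fine (limn_esup (fun n => (w n x)%:E)).

Lemma measurable_L2lim : measurable_fun setT L2lim.
Proof.
apply: measurableT_comp => //.
by apply: measurable_fun_limn_esup => n; exact/measurable_EFinP.
Qed.

Lemma ae_cvg_L2lim : {ae mu, forall x, w n x @[n --> \oo] --> L2lim x}.
Proof.
apply: filterS ae_cvg_seq => x cw.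
have cwE : (w n x)%:E @[n --> \oo] --> (limn (w ^~ x))%:E.
  by apply: cvg_EFin => //; exact: nearW.
rewrite /L2lim is_cvg_limn_esupE; last by apply/cvg_ex; exists (limn (w ^~ x))%:E.
by rewrite (cvg_lim _ cwE).
Qed.

(** Riesz-Fischer: Fatou's lemma passes the tail bound to the limit. *)
Lemma sqint_L2lim n : (sqint (L2lim \- w n)%R <= (4 * (2^-1 ^+ n) ^+ 2)%:E)%E.
Proof.
pose F k x := ((w (n + k) \- w n) x ^+ 2)%:E.
have mF k : measurable_fun setT (F k) by exact: measurable_sqr.
have F_ge0 k x : (0 <= F k x)%E by exact: sqr_ge0E.
have -> : sqint (L2lim \- w n) = (\int[mu]_x limn_einf (F ^~ x))%E.
  apply: ae_eq_integral => //.
  - apply: measurable_sqr; apply: measurable_funB => //.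
    exact: measurable_L2lim.
  - rewrite (_ : (fun x => _) = fun x => (- limn_esup (-%E \o F ^~ x))%E).
      apply: measurableT_comp => //; apply: measurable_fun_limn_esup => k.
      exact: measurableT_comp.
    by apply/funext => x; rewrite limn_esupN oppeK.
  - apply: filterS ae_cvg_L2lim => x cwx _.
    suff : F k x @[k --> \oo] --> ((L2lim \- w n) x ^+ 2)%:E.
      move=> cF; rewrite is_cvg_limn_einfE; first by rewrite (cvg_lim _ cF).
      by apply/cvg_ex; eexists; exact: cF.
    apply: cvg_EFin; first exact: nearW.
    suff cnk : w (n + k)%N x @[k --> \oo] --> L2lim x.
      by apply: cvgM; apply: cvgB => //; exact: cvg_cst.
    by under eq_fun do rewrite addnC; move: cwx; rewrite -(cvg_shiftn n).
apply: (le_trans (fatou _ _ _ _)) => //.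
rewrite limn_einf_lim; apply: lime_le; first exact: is_cvg_einfs.
apply: nearW => k; apply: le_trans (sqint_tail n k).
by apply: ereal_inf_lbound; exists k => /=.
Qed.

End riesz_fischer.

Section integral_facts.
Context (R : realType) d (X : measurableType d) (mu : probability X R).

Lemma sqint_eq0 (f : X -> R) : measurable_fun setT f ->
  sqint mu f = 0%E <-> {ae mu, forall x, f x = 0}.
Proof.
move=> mf.
have -> : sqint mu f = (\int[mu]_x `|(f x ^+ 2)%:E|)%E.
  by apply: eq_integral => x _; rewrite gee0_abs ?sqr_ge0E.
split.
  move/(ae_eq_integral_abs mu measurableT (measurable_sqr mf)).
  apply: filterS => x /(_ I) [] /eqP.
  by rewrite sqrf_eq0 => /eqP.
move=> f0; apply/(ae_eq_integral_abs mu measurableT (measurable_sqr mf)).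
by apply: filterS f0 => x -> _ /=; rewrite expr0n.
Qed.

Lemma ae_eq0_of_integral_eq0 (f : X -> R) : measurable_fun setT f ->
  {ae mu, forall x, 0 <= f x} -> (\int[mu]_x (f x)%:E = 0)%E ->
  {ae mu, forall x, f x = 0}.
Proof.
move=> mf f_ge0 int0.
have mfE : measurable_fun setT (EFin \o f) by exact/measurable_EFinP.
have : (\int[mu]_x `|(EFin \o f) x| = 0)%E.
  rewrite -int0; apply: ae_eq_integral => //; first exact: measurableT_comp.
  by apply: filterS f_ge0 => x fx _; rewrite /= ger0_norm.
move/(ae_eq_integral_abs mu measurableT mfE).
by apply: filterS => x /(_ I) [].
Qed.

End integral_facts.

(** * Square-integrable functions modulo constants *)

Lemma lee12 (R : realType) : (1 <= 2%:E :> \bar R)%E.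
Proof. by rewrite lee1n. Qed.

Section covariance_space.
Context d (X : measurableType d) (R : realType) (mu : probability X R).

Definition L2 := LfunType mu (lee12 R).
Implicit Types f g h : L2.

Let mu_fin : mu setT \is a fin_num := fin_num_measure mu _ measurableT.
Let L2_2 f : (f : X -> R) \in Lfun mu 2%:E := LfunP f.
Let L2_1 f : (f : X -> R) \in Lfun mu 1 := Lfun_subset12 mu_fin (L2_2 f).
Let L2_11 f g : (f \* g : X -> R) \in Lfun mu 1 := Lfun2_mul_Lfun1 (L2_2 f) (L2_2 g).

(** The covariance of square-integrable functions is finite, so that [fine]
    loses nothing, see [covE]. *)
Definition cov f g : R := fine (covariance mu f g).

Lemma Lfun2D (f g : X -> R) : f \in Lfun mu 2%:E -> g \in Lfun mu 2%:E ->
  f \+ g \in Lfun mu 2%:E.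
Proof. by have [_] := Lfun_addr_closed mu (lee12 R); exact. Qed.

Lemma covE f g : (cov f g)%:E = covariance mu f g.
Proof.
rewrite fineK//.
exact: (covariance_fin_num (L2_1 f) (L2_1 g) (L2_11 f g)).
Qed.

Lemma covC f g : cov f g = cov g f.
Proof. by rewrite /cov covarianceC. Qed.

Lemma covDl f g h : cov (f + g) h = cov f h + cov g h.
Proof.
apply: EFin_inj; rewrite [RHS]EFinD !covE.
exact: (covarianceDl (L2_2 f) (L2_2 g) (L2_2 h)).
Qed.

Lemma covZl (a : R) f g : cov (a *: f) g = a * cov f g.
Proof.
apply: EFin_inj; rewrite [RHS]EFinM !covE.
rewrite -(covarianceZl a (L2_1 f) (L2_1 g) (L2_11 f g)).
by congr (covariance mu _ _); apply/funext => x /=; exact: mulrC.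
Qed.

Lemma cov_ge0 f : 0 <= cov f f.
Proof. by rewrite -lee_fin covE; exact: variance_ge0. Qed.

Lemma variance_sqint (f : X -> R) :
  variance mu f = sqint mu (f \- cst (fine (expectation mu f))).
Proof.
rewrite /variance !unlock /sqint; apply: eq_integral => x _.
by rewrite expr2.
Qed.

Lemma variance_le_sqint (f : X -> R) : f \in Lfun mu 2%:E ->
  (variance mu f <= sqint mu f)%E.
Proof.
move=> f2; rewrite varianceE//.
have -> : expectation mu (f ^+ 2) = sqint mu f by rewrite unlock.
have Ef : expectation mu f \is a fin_num.
  exact/expectation_fin_num/(Lfun_subset12 mu_fin f2).
by rewrite leeBlDr ?fin_numX// leeDl// sqre_ge0.
Qed.

(** Subtracting means turns variances into squared L2 norms, to which
    Riesz-Fischer applies; the variance ignores the constants that were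
    subtracted. *)
Lemma cov_complete (u : nat -> L2) :
  (forall n, cov (u n.+1 - u n) (u n.+1 - u n) <= (2^-1 ^+ n) ^+ 2) ->
  exists l, forall e : R, 0 < e -> exists N, forall n, (N <= n)%N ->
    cov (u n - l) (u n - l) < e.
Proof.
move=> u_close.
pose c n : R := fine (expectation mu (u n)).
pose w n : X -> R := u n \- cst (c n).
have mw n : measurable_fun setT (w n) by apply: measurable_funB => //.
have w_close n : (sqint mu (w n.+1 \- w n)%R <= ((2^-1 ^+ n) ^+ 2)%:E)%E.
  have := u_close n; rewrite -lee_fin covE -/(variance _ _) variance_sqint.
  congr (sqint mu _ <= _)%E; apply/funext => x /=; rewrite !fctE/=.
  rewrite expectationB// fineB ?expectation_fin_num// -/(c _) -/(c _).
  by rewrite /w /=; ring.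
have wl := sqint_L2lim mw w_close.
have l2 : L2lim w \in Lfun mu 2%:E.
  have -> : L2lim w = (L2lim w \- w 0%N) \+ (u 0%N \- cst (c 0%N)).
    by apply/funext => x /=; rewrite subrK.
  apply: Lfun2D.
    apply: Lfun2P; last by apply: le_lt_trans (wl 0%N) _; rewrite ltry.
    exact/measurable_funB/mw/measurable_L2lim.
  have -> : u 0%N \- cst (c 0%N) = u 0%N \+ cst (- c 0%N) by [].
  by apply: Lfun2D => //; exact: Lfun_cst.
exists (Lfun_Sub (lee12 R) l2) => e e0.
have half_lt1 : `|2^-1 : R| < 1.
  by rewrite ger0_norm ?invr_ge0// invf_lt1// ltr1n.
have /cvgr0Pnorm_lt/(_ (Num.sqrt (e / 4))) := cvg_expr half_lt1.
case; [by rewrite sqrtr_gt0 divr_gt0|move=> N _ hN].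
exists N => n Nn.
rewrite -lte_fin covE; apply: (@le_lt_trans _ _ (sqint mu (L2lim w \- w n)%R)).
  set l := Lfun_Sub _ _.
  have -> : L2lim w \- w n = (\- (u n - l : L2)) \+ cst (c n).
    by apply/funext => x; rewrite /= !fctE (_ : w n x = u n x - c n)// /=; ring.
  have ul2 : \- (u n - l : L2) \in Lfun mu 2%:E by rewrite rpredN.
  rewrite -/(variance mu (u n - l : L2)) -varianceN//.
  rewrite -(varianceD_cst_r (c n) ul2); apply: variance_le_sqint.
  by apply: Lfun2D => //; exact: Lfun_cst.
apply: (le_lt_trans (wl n)); rewrite lte_fin mulrC -ltr_pdivlMr//.
have := hN n Nn; rewrite -ltr_sqr ?nnegrE ?sqrtr_ge0//.
by rewrite real_normK ?num_real// sqr_sqrtr// divr_ge0// ltW.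
Qed.

Definition cov_prehilbert : prehilbert R :=
  PreHilbert covC covDl covZl cov_ge0 cov_complete.
End covariance_space.

(** * The Koopman representation *)

Lemma countable_enum (T : Type) : countable [set: T] -> T ->
  {e : nat -> T | forall t, exists n, e n = t}.
Proof.
move=> cT t0; apply/cid; have /pfcard_geP[T0|[e]] : ([set: T] #<= [set: nat])%card by [].
  by have : [set: T] t0 by []; rewrite T0.
by exists e => t; have [n _ <-] := @surj _ _ _ _ e t I; exists n.
Qed.

Section action_lemmas.
Variables (R : realType) (G : groupType).
Context d (X : measurableType d) (mu : probability X R) (a : pmp_action G mu).

Lemma actK g x : a g^-1%g (a g x) = x.
Proof. by rewrite -actM mulVg act1. Qed.

Lemma actVK g x : a g (a g^-1%g x) = x.
Proof. by rewrite -actM mulgV act1. Qed.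

Lemma act_image g (A : set X) : a g @` A = a g^-1%g @^-1` A.
Proof.
apply/seteqP; split=> [_ [x Ax <-]|x /= Ax]; first by rewrite /= actK.
by exists (a g^-1%g x) => //; rewrite actVK.
Qed.

Lemma measurable_act_preimage g (A : set X) : measurable A ->
  measurable (a g @^-1` A).
Proof. by move=> mA; rewrite -[X in measurable X]setTI; exact: act_measurable. Qed.

Lemma ge0_integral_act g (f : X -> \bar R) : measurable_fun setT f ->
  (forall x, 0 <= f x)%E -> (\int[mu]_x f (a g x) = \int[mu]_x f x)%E.
Proof.
move=> mf f0.
rewrite -[LHS](ge0_integral_pushforward (act_measurable a g) mu measurableT mf)//.
by apply: eq_measure_integral => [|? A mA _]; [exact: act_measurable|exact: act_measure].
Qed.

Lemma Lfun2_act g (f : X -> R) :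
  f \in Lfun mu 2%:E -> f \o a g \in Lfun mu 2%:E.
Proof.
move=> f2; have mf := Lfun_measurable f2.
apply: Lfun2P; first exact: (measurableT_comp mf (act_measurable a g)).
rewrite /sqint (ge0_integral_act g (measurable_sqr mf) (sqr_ge0E f)).
by have /integrableP[_] := Lfun2_integrable_sqr f2;
  under eq_integral do rewrite gee0_abs ?sqr_ge0E//.
Qed.

Lemma expectation_act g (f : X -> R) : f \in Lfun mu 1 -> f \o a g \in Lfun mu 1 ->
  expectation mu (f \o a g) = expectation mu f.
Proof.
move=> f1 fg1; rewrite unlock.
have mf : measurable_fun setT (EFin \o f).
  exact/measurable_EFinP/(Lfun_measurable f1).
have intfg : mu.-integrable setT ((EFin \o f) \o a g) by apply/Lfun1_integrable.
rewrite -[LHS](integral_pushforward (act_measurable a g) mf intfg measurableT).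
by apply: eq_measure_integral => [|? A mA _]; [exact: act_measurable|exact: act_measure].
Qed.

Let mu_fin : mu setT \is a fin_num := fin_num_measure mu _ measurableT.

Lemma Lfun21 (f : X -> R) : f \in Lfun mu 2%:E -> f \in Lfun mu 1.
Proof. exact: Lfun_subset12. Qed.

(** The inverse makes this a left action. *)
Definition L2act g (f : L2 mu) : L2 mu :=
  Lfun_Sub (lee12 R) (Lfun2_act g^-1%g (LfunP f)).

Lemma L2act1 f : L2act 1%g f = f.
Proof. by apply/val_inj/funext => x; rewrite /= invg1 act1. Qed.

Lemma L2actM g h f : L2act (g * h)%g f = L2act g (L2act h f).
Proof. by apply/val_inj/funext => x; rewrite /= invgM actM. Qed.

Lemma L2act_cov g (f f' : L2 mu) : cov (L2act g f) (L2act g f') = cov f f'.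
Proof.
have h2 (k : L2 mu) : (k : X -> R) \in Lfun mu 2%:E := LfunP k.
have h1 (k : L2 mu) : (k : X -> R) \in Lfun mu 1 := Lfun21 (h2 k).
have p1 (k k' : L2 mu) : (k \* k' : X -> R) \in Lfun mu 1 := Lfun2_mul_Lfun1 (h2 k) (h2 k').
rewrite /cov (covarianceE (h1 _) (h1 _) (p1 _ _)).
rewrite (covarianceE (h1 f) (h1 f') (p1 f f')).
have E1 (k : L2 mu) : expectation mu (L2act g k) = expectation mu k :=
  expectation_act (h1 k) (h1 (L2act g k)).
have E2 : expectation mu (L2act g f \* L2act g f') = expectation mu (f \* f') :=
  expectation_act (p1 f f') (p1 (L2act g f) (L2act g f')).
by rewrite !E1 E2.
Qed.

Definition koopman : unitary_rep G (hspace_hilbert (cov_prehilbert mu)) :=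
  @hspace_rep R G (cov_prehilbert mu) L2act L2act1 L2actM L2act_cov.

Lemma koopman_pair g (f f' : cov_prehilbert mu) :
  koopman g (hpair f f') = hpair (L2act g f : cov_prehilbert mu) (L2act g f').
Proof. exact: (@hspace_act_pair R G (cov_prehilbert mu) L2act L2act1 L2actM L2act_cov). Qed.

End action_lemmas.

(** * Total ergodicity passes to the Koopman representation *)

Section ergodicity.
Variables (R : realType) (G : groupType).
Hypothesis G_countable : countable [set: G].
Context d (X : measurableType d) (mu : probability X R) (a : pmp_action G mu).
Variable H : set G.
Hypothesis H_subgroup : subgroup H.

Let H1 : H 1%g. Proof. by have [/set_mem] := H_subgroup. Qed.
Let HV h : H h -> H h^-1%g.
Proof.
move=> Hh; have [_ /(_ 1%g h)] := H_subgroup.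
by rewrite !inE div1g; apply.
Qed.
Let HM h k : H h -> H k -> H (h * k)%g.
Proof.
move=> Hh Hk; have [_ /(_ h k^-1%g)] := H_subgroup.
by rewrite !inE invgK; apply => //; exact: HV.
Qed.

(** The largest H-invariant subset of E.  It turns invariance up to null sets
    into the strict invariance that the definition of ergodicity requires. *)
Definition orbit_core (E : set X) : set X := [set x | forall h, H h -> E (a h x)].

Lemma orbit_core_invariant E h : H h -> a h @` orbit_core E = orbit_core E.
Proof.
move=> Hh; rewrite act_image; apply/seteqP; split=> x /= Ex k Hk.
  have := Ex (k * h)%g (HM Hk Hh).
  by rewrite actM actVK.
by rewrite -actM; apply: Ex; apply: HM => //; exact: HV.
Qed.

Lemma measurable_orbit_core E : measurable E -> measurable (orbit_core E).
Proof.
move=> mE; have [e eP] := countable_enum G_countable 1%g.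
have -> : orbit_core E = \bigcap_n [set x | H (e n) -> E (a (e n) x)].
  apply/seteqP; split=> [x Ex n _ /=|x Ex h]; first exact: Ex.
  by have [n <-] := eP h; exact: Ex.
apply: bigcapT_measurable => n.
have [Hn|Hn] := pselect (H (e n)).
  rewrite (_ : [set x | _] = a (e n) @^-1` E); first exact: measurable_act_preimage.
  by apply/seteqP; split=> x /=; [exact|move=> + _].
by rewrite (_ : [set x | _] = setT)//; apply/seteqP; split=> // x _ /Hn.
Qed.

(** The level m is the mean of f.  The superlevel set E at m agrees almost
    everywhere with its orbit core, as H is countable, so it is null or conull.
    Either way f - m has a constant sign almost everywhere, and a function of
    constant sign with integral 0 vanishes almost everywhere. *)
Lemma ergodic_ae_constant (f : X -> R) : ergodic_on a H ->
  f \in Lfun mu 2%:E -> (forall h, H h -> {ae mu, forall x, f (a h x) = f x}) ->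
  variance mu f = 0%E.
Proof.
move=> erg f2 f_inv.
have mf := Lfun_measurable f2; have f1 := Lfun21 f2.
set m : R := fine (expectation mu f).
have mfm : measurable_fun setT (f \- cst m) by exact: measurable_funB.
have int0 : (\int[mu]_x ((f \- cst m) x)%:E = 0)%E.
  have -> : (\int[mu]_x ((f \- cst m) x)%:E)%E = expectation mu (f \- cst m).
    by rewrite unlock.
  rewrite expectationB ?Lfun_cst// expectation_cst /m fineK ?expectation_fin_num//.
  by rewrite subee// expectation_fin_num.
rewrite variance_sqint -/m; apply/sqint_eq0 => //.
pose E := [set x | m < f x].
have mE : measurable E.
  have -> : E = f @^-1` `]m, +oo[ by apply/seteqP; split=> x; rewrite /E/= in_itv/= andbT.
  by rewrite -[X in measurable X]setTI; exact: mf.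
have f_inv_all : {ae mu, forall x, forall h, H h -> f (a h x) = f x}.
  have [e eP] := countable_enum G_countable 1%g.
  have : {ae mu, forall x, forall n, H (e n) -> f (a (e n) x) = f x}.
    apply: ae_foralln => n; have [Hn|Hn] := pselect (H (e n)).
      by apply: filterS (f_inv _ Hn) => x.
    by apply: nearW => x /Hn.
  by apply: filterS => x fx h; have [n <-] := eP h; exact: fx.
have coreE : {ae mu, forall x, orbit_core E x <-> m < f x}.
  apply: filterS f_inv_all => x fx; split=> [/(_ 1%g H1)|mx h Hh].
    by rewrite /E/= act1.
  by rewrite /E/= fx.
have mC := measurable_orbit_core mE.
have [C0|C1] := erg _ mC (fun h => @orbit_core_invariant E h).
- have f_le : {ae mu, forall x, 0 <= (cst m \- f) x}.
    have outC : {ae mu, forall x, ~ orbit_core E x}.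
      by exists (orbit_core E); split => // x /= /contrapT.
    apply: filterS2 coreE outC => x xE xC /=.
    by rewrite subr_ge0 leNgt; apply/negP => /xE.
  have int0' : (\int[mu]_x ((cst m \- f) x)%:E = 0)%E.
    have -> : (\int[mu]_x ((cst m \- f) x)%:E)%E = expectation mu (cst m \- f).
      by rewrite unlock.
    rewrite expectationB ?Lfun_cst// expectation_cst /m fineK ?expectation_fin_num//.
    by rewrite subee// expectation_fin_num.
  apply: filterS (ae_eq0_of_integral_eq0 _ f_le int0'); last exact: measurable_funB.
  by move=> x /= h; rewrite -opprB h oppr0.
- apply: ae_eq0_of_integral_eq0 => //.
  have inC : {ae mu, forall x, orbit_core E x}.
    exists (~` orbit_core E); split => //; first exact: measurableC.
    by rewrite probability_setC// C1 subee.
  by apply: filterS2 coreE inC => x xE /xE /ltW; rewrite /= subr_ge0.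
Qed.

(** A null variance only says that f o g - f is almost everywhere constant; the
    constant is 0 because g preserves the mean. *)
Lemma L2act_fixed_ae (k : L2 mu) g :
  cov (L2act a g^-1%g k - k) (L2act a g^-1%g k - k) = 0 ->
  {ae mu, forall x, k (a g x) = k x}.
Proof.
move=> cov0; pose z : X -> R := (k \o a g) \- k.
have k1 : (k : X -> R) \in Lfun mu 1 := Lfun21 (LfunP k).
have kg1 : (k : X -> R) \o a g \in Lfun mu 1 := Lfun21 (Lfun2_act a g (LfunP k)).
have Ez : expectation mu z = 0%E.
  rewrite expectationB// (expectation_act k1 kg1).
  by rewrite subee// expectation_fin_num.
have : variance mu z = 0%E.
  rewrite -[RHS]/(0%:E) -cov0 covE.
  by congr (covariance mu _ _); apply/funext => x; rewrite /z/= invgK.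
rewrite variance_sqint Ez => /sqint_eq0 z0.
have : {ae mu, forall x, (z \- cst (fine 0%E)) x = 0}.
  apply: z0; apply: measurable_funB => //.
  by apply: measurable_funB; [exact: Lfun_measurable kg1|exact: Lfun_measurable k1].
by apply: filterS => x; rewrite /= subr0 /z /= => /eqP; rewrite subr_eq0 => /eqP.
Qed.

Lemma koopman_fixed_vector (phi : hspace (cov_prehilbert mu)) : ergodic_on a H ->
  (forall h, H h -> koopman a h phi = phi) -> phi = 0.
Proof.
move=> erg; rewrite -(hpairK phi); move: (hre phi) (him phi) => f g fixed.
have null (k : L2 mu) : (forall h, H h -> cov (L2act a h k - k) (L2act a h k - k) = 0) ->
    cov k k = 0.
  move=> k_inv; rewrite /cov -/(variance _ _).
  have -> // : variance mu k = 0%E.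
  apply: ergodic_ae_constant => // [|h Hh]; first exact: LfunP.
  by apply/L2act_fixed_ae/k_inv/HV.
have fixed_cov h : H h -> cov (L2act a h f - f) (L2act a h f - f) +
    cov (L2act a h g - g) (L2act a h g - g) = 0.
  move=> Hh; apply: realC_inj.
  rewrite -(@hspace_dot_sqr R (cov_prehilbert mu)) -hpairB.
  rewrite -(koopman_pair a h f g) [X in X - _]fixed// subrr.
  by rewrite linear0l.
have f0 : cov f f = 0.
  apply: null => h Hh; have /eqP := fixed_cov h Hh.
  by rewrite paddr_eq0 ?cov_ge0// => /andP[/eqP].
have g0 : cov g g = 0.
  apply: null => h Hh; have /eqP := fixed_cov h Hh.
  by rewrite paddr_eq0 ?cov_ge0// => /andP[_ /eqP].
apply/normr0_eq0/eqP; rewrite -sqrf_eq0 sqr_norm_hpair.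
by rewrite [pform _ _]f0 [X in _ + X]g0 addr0.
Qed.

End ergodicity.

Lemma koopman_totally_ergodic (R : realType) (G : groupType)
    d (X : measurableType d) (mu : probability X R) (a : pmp_action G mu) :
  countable [set: G] -> totally_ergodic_action a ->
  totally_ergodic_rep (koopman a).
Proof.
move=> G_countable erg H Hsub Hfin.
apply/seteqP; split=> [phi fixed|_ -> h _]; last exact: linear0.
exact: (koopman_fixed_vector G_countable Hsub (erg H Hsub Hfin) fixed).
Qed.

(** * Saturations of a set by a cyclic subgroup *)

Section cyclic.
Variable G : groupType.
Implicit Types (C : set G) (g c : G).

Lemma cyclic_subgroup_mul C g c : cyclic_subgroup C ->
  C g -> C c -> C (g * c)%g /\ C (g^-1 * c)%g.
Proof.
move=> [g0 ->].
set Z := [set x | _].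
have Zg c0 : Z c0 -> Z (g0 * c0)%g.
  move=> [n [->|->]]; first by exists n.+1; left; rewrite expgS.
  case: n => [|n]; first by exists 1%N; left; rewrite expg0 invg1 mulg1.
  by exists n; right; rewrite expgSr invgM mulVKg.
have ZV c0 : Z c0 -> Z (g0^-1 * c0)%g.
  move=> [n [->|->]]; last by exists n.+1; right; rewrite expgSr invgM.
  case: n => [|n]; first by exists 1%N; right; rewrite expg0 mulg1.
  by exists n; left; rewrite expgS mulKg.
have Zpow n c0 : Z c0 -> Z (g0 ^+ n * c0)%g.
  move=> Zc; elim: n => [|n IH]; first by rewrite expg0 mul1g.
  by rewrite expgS -mulgA; exact: Zg.
have ZpowV n c0 : Z c0 -> Z (g0 ^- n * c0)%g.
  move=> Zc; elim: n => [|n IH]; first by rewrite expg0 invg1 mul1g.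
  by rewrite expgSr invgM -mulgA; exact: ZV.
move=> [n [->|->]] Zc; split; rewrite ?invgK; by [exact: Zpow|exact: ZpowV].
Qed.

Lemma cyclic_subgroup1 C : cyclic_subgroup C -> C 1%g.
Proof. by move=> [g ->]; exists 0%N; left; rewrite expg0. Qed.

End cyclic.

Section expansion.
Variables (R : realType) (G : groupType).
Hypothesis G_countable : countable [set: G].
Context d (X : measurableType d) (mu : probability X R) (a : pmp_action G mu).

Lemma measurable_saturation (C : set G) (B : set X) : measurable B ->
  measurable (\bigcup_(c in C) (a c @` B)).
Proof.
move=> mB; rewrite bigcup_mkcond; apply: countable_bigcupT_measurable => // c.
by case: ifP => // _; rewrite act_image; exact: measurable_act_preimage.
Qed.

Lemma Lfun2_indic (A : set X) : measurable A -> (\1_A : X -> R) \in Lfun mu 2%:E.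
Proof.
move=> mA; apply: Lfun2P; first exact: measurable_indic.
rewrite /sqint; under eq_integral.
  move=> x _; rewrite (_ : \1_A x ^+ 2 = \1_A x :> R); first over.
  by rewrite indicE; case: (_ \in _); rewrite ?expr1n ?expr0n.
by rewrite /= integral_indic// setIT (le_lt_trans (probability_le1 _ _))// ltry.
Qed.

Definition L2indic (A : set X) (mA : measurable A) : L2 mu :=
  Lfun_Sub (lee12 R) (Lfun2_indic mA).

(** For A contained in B this is mu(A) (1 - mu(B)). *)
Lemma cov_indic (A B : set X) (mA : measurable A) (mB : measurable B) :
  ((cov (L2indic mA) (L2indic mB))%:E = mu (A `&` B) - mu A * mu B)%E.
Proof.
have A2 := Lfun2_indic mA; have B2 := Lfun2_indic mB.
have AB1 : (\1_A \* \1_B : X -> R) \in Lfun mu 1 := Lfun2_mul_Lfun1 A2 B2.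
rewrite covE (covarianceE (Lfun21 A2) (Lfun21 B2) AB1) !expectation_indic//.
rewrite (_ : (\1_A * \1_B)%R = \1_(A `&` B) :> (X -> R)); last by rewrite indicI.
by rewrite expectation_indic//; exact: measurableI.
Qed.

End expansion.

Section indicators.
Variables (R : realType) (G : groupType).
Context d (X : measurableType d) (mu : probability X R) (a : pmp_action G mu).

(** The class of 1_A modulo constants stands for 1_A - mu(A). *)
Definition centered_indic (A : set X) (mA : measurable A) :
  hspace_hilbert (cov_prehilbert mu) := hpair (L2indic mu mA : cov_prehilbert mu) 0.

Lemma hnorm_centered_indic A (mA : measurable A) : hnorm (centered_indic mA) <= 1.
Proof.
rewrite -(@ler_sqr R) ?nnegrE ?hnorm_ge0// expr1n.
have -> : hnorm (centered_indic mA) ^+ 2 = cov (L2indic mu mA) (L2indic mu mA).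
  apply: realC_inj; rewrite -hdot_sqr.
  have := @hspace_dot_sqr R (cov_prehilbert mu) (L2indic mu mA) 0.
  by rewrite pform0l addr0.
rewrite -lee_fin cov_indic setIid.
apply: (@le_trans _ _ (mu A)); last exact: probability_le1.
by rewrite leeBlDr ?fin_numM ?fin_num_measure// leeDl// mule_ge0.
Qed.

Lemma hdot_centered_indic A B (mA : measurable A) (mB : measurable B) :
  hdot (hspace_hilbert (cov_prehilbert mu)) (centered_indic mA) (centered_indic mB) =
  real_complex R (cov (L2indic mu mA) (L2indic mu mB)).
Proof.
have := @hspace_dotE R (cov_prehilbert mu) (L2indic mu mA) 0 (L2indic mu mB) 0.
by rewrite !pform0l (pformC _ 0) pform0l subrr addr0.
Qed.

(** The saturation of B by C is a C-invariant set, so its indicator is a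
    C-invariant function. *)
Lemma centered_indic_fixed (C : set G) (B : set X)
    (mY : measurable (\bigcup_(c in C) (a c @` B))) :
  cyclic_subgroup C -> fixed_vectors (koopman a) C (centered_indic mY).
Proof.
move=> cC g Cg; rewrite /centered_indic koopman_pair.
congr hpair; apply/val_inj/funext => x //=.
rewrite !indicE; congr (_%:R); congr nat_of_bool.
apply/idP/idP => /[!inE] -[c Cc]; rewrite act_image /= => Bx.
- exists (g * c)%g; first by have [] := cyclic_subgroup_mul cC Cg Cc.
  by rewrite act_image/= invgM actM.
- exists (g^-1 * c)%g; first by have [] := cyclic_subgroup_mul cC Cg Cc.
  by rewrite act_image/= invgM invgK actM actVK.
Qed.

End indicators.

Theorem lemma1p3 (R : realType) (G : groupType) :
  infinite_set [set: G] -> countable [set: G] ->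
  cyclic_escape R G ->
  forall (d : measure_display) (X : measurableType d) (mu : probability X R)
    (a : pmp_action G mu),
    totally_ergodic_action a -> directionally_expansive a.
Proof.
move=> _ G_countable escape d X mu a erg B mB B_gt0 eps eps_gt0.
have muB : mu B = (fine (mu B))%:E by rewrite fineK// fin_num_measure.
set b := fine (mu B) in muB; have b_gt0 : 0 < b by rewrite -lte_fin -muB.
have escB := escape _ _ (koopman_totally_ergodic G_countable erg)
  (centered_indic mu mB).
have : (0 < (eps * b)%:E)%E by rewrite lte_fin mulr_gt0.
rewrite -escB => /ereal_inf_lt[_ [C [cC _] <-]].
rewrite lte_fin => proj_lt; exists C => //.
have mY := measurable_saturation G_countable a C mB.
set Y := \bigcup_(c in C) _ in mY *.
have muY : mu Y = (fine (mu Y))%:E by rewrite fineK// fin_num_measure.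
rewrite muY lte_fin.
have BY : B `&` Y = B.
  apply/setIidl => x Bx; exists 1%g; first exact: cyclic_subgroup1.
  by exists x => //; rewrite act1.
have covBY : cov (L2indic mu mB) (L2indic mu mY) = b * (1 - fine (mu Y)).
  apply: EFin_inj; rewrite cov_indic BY muB muY -EFinM -EFinB; congr EFin; ring.
have := hdot_fixed_le (centered_indic mu mB) (centered_indic_fixed mY cC).
set p := hnorm _ in proj_lt *.
rewrite hdot_centered_indic covBY ger0_norm; last first.
  rewrite ler0c mulr_ge0 ?(ltW b_gt0)// subr_ge0.
  by rewrite -lee_fin -muY probability_le1.
rewrite lecR => le_p.
have p_ge0 : 0 <= p := hnorm_ge0 _.
have : b * (1 - fine (mu Y)) < b * eps.
  rewrite [ltRHS]mulrC; apply: le_lt_trans proj_lt; apply: le_trans le_p _.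
  by rewrite ler_piMr// hnorm_centered_indic.
by rewrite ltr_pM2l//; lra.
Qed.
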